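(* There is a positive constant $C$ and infinitely many integers $n$ with $$ D(n)>1-\frac{C}{(\log\log n)^{1-\frac{1}{2}{\rm e}\log 2}\sqrt{\log\log\log n}}. $$
   Context: For a positive integer $n$, a set $S\subseteq \mathbb{Z}/n\mathbb{Z}$ is called product-free if there are no $a,b,c\in S$ (not necessarily distinct) with $ab\equiv c \pmod n$. For such $S$ let $D(S)=|S|/n$, and let $D(n)$ denote the maximum of $D(S)$ over all product-free sets $S\subseteq\mathbb{Z}/n\mathbb{Z}$. Here $\log$ is the natural logarithm and ${\rm e}$ is Euler's number. *)

(* Defs.v *)
From mathcomp Require Import all_boot all_order all_algebra.
From mathcomp Require Import all_classical all_reals all_analysis.

Set Implicit Arguments.
Unset Strict Implicit.
Unset Printing Implicit Defensive.

Import Order.TTheory GRing.Theory Num.Theory.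

Local Open Scope ring_scope.

(* Z/nZ is represented by its least residues 'I_n, which is correct for every
   n > 0; the ring 'Z_n is Z/2Z when n = 1. *)
Definition product_free (n : nat) (S : {set 'I_n}) : bool :=
  [forall a in S, forall b in S, forall c in S, (a * b != c %[mod n])%N].

Definition density (R : realType) (n : nat) (S : {set 'I_n}) : R :=
  #|S|%:R / n%:R.

(* The default value 0 of the iterated maximum is the density of the
   product-free set set0. *)
Definition max_density (R : realType) (n : nat) : R :=
  \big[Num.max/0]_(S : {set 'I_n} | product_free S) density R S.

(* Main.v *)
Require Import Defs.
From mathcomp Require Import all_boot all_order all_algebra.
From mathcomp Require Import all_classical all_reals all_analysis.
From mathcomp Require Import zify ring lra.

Import Order.TTheory GRing.Theory Num.Theory.

Local Open Scope ring_scope.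

(** Let [n] be the product of [p ^ x] over the primes [p <= x], let [Omega m]
    be the number of prime factors of [gcd (m, n)] counted with multiplicity,
    and let [S] be the set of residues [m] with [k <= Omega m < 2 k]. Since
    [Omega (a b) >= min (x, Omega a + Omega b)], [S] is product-free as soon as
    [2 k <= x]. By the Chinese remainder theorem [Omega] is a sum of independent
    truncated geometric variables, whose generating function is dominated
    coefficientwise by that of a Poisson law of parameter [l = sum 1 / p] times
    a factor [K] that stays bounded at the relevant points. The two tails of
    [Omega] outside [S] are therefore at most a constant times [exp (- l) l^J / J!] with
    [J = k] and [J = 2 k]. They balance for [k = e l / 4], where Stirling's
    bound gives [exp (- (1 - e (ln 2) / 2) l) / sqrt l]; finally Euler's product
    gives [l >= ln (ln x) - 2], and [ln (ln (ln n)) <= l + 4]. *)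

(** * Valuations truncated at [e] and their behaviour under products *)

Section CutValuation.
Local Open Scope nat_scope.

(* The gcd truncates the valuation at [e], and gives [e] (not [logn p 0 = 0])
   at [m = 0]. *)
Definition cut_val (e p m : nat) : nat := logn p (gcdn m (p ^ e)).

Lemma cut_val_mod e p q m : p ^ e %| q -> cut_val e p (m %% q) = cut_val e p m.
Proof.
move=> dvq; rewrite /cut_val; congr logn.
by rewrite -[LHS]gcdn_modl modn_dvdm // gcdn_modl.
Qed.

Lemma cut_valS_mul e p q : prime p -> cut_val e.+1 p (p * q) = (cut_val e p q).+1.
Proof.
move=> pp; rewrite /cut_val expnS -muln_gcdr lognM ?(prime_gt0 pp) //.
  by rewrite logn_prime // eqxx.
by rewrite gcdn_gt0 expn_gt0 (prime_gt0 pp) orbT.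
Qed.

Lemma cut_val_ndvd e p m : prime p -> ~~ (p %| m) -> cut_val e p m = 0.
Proof.
move=> pp ndv; rewrite /cut_val.
have -> : gcdn m (p ^ e) = 1; last exact: logn1.
by apply/eqP; rewrite -/(coprime _ _) coprimeXr // coprime_sym prime_coprime.
Qed.

Lemma cut_val_dvd e p m i : prime p -> i <= e -> p ^ i %| m -> i <= cut_val e p m.
Proof.
move=> pp ie dv; rewrite /cut_val -pfactor_dvdn //.
  by rewrite dvdn_gcd dv dvdn_exp2l.
by rewrite gcdn_gt0 expn_gt0 (prime_gt0 pp) orbT.
Qed.

Lemma pfactor_cut_val_dvd e p m : prime p -> p ^ cut_val e p m %| m.
Proof.
move=> pp; apply: dvdn_trans (dvdn_gcdl m (p ^ e)).
by rewrite /cut_val pfactor_dvdn // gcdn_gt0 expn_gt0 (prime_gt0 pp) orbT.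
Qed.

Lemma cut_val_mul e p a b : prime p ->
  minn e (cut_val e p a + cut_val e p b) <= cut_val e p (a * b).
Proof.
move=> pp; apply: cut_val_dvd => //; first exact: geq_minl.
apply: (@dvdn_trans (p ^ (cut_val e p a + cut_val e p b))).
  by rewrite dvdn_exp2l // geq_minr.
by rewrite expnD dvdn_mul // pfactor_cut_val_dvd.
Qed.

Definition cut_Omega (e : nat) (s : seq nat) (m : nat) : nat :=
  \sum_(p <- s) cut_val e p m.

(** Since [minn e (u + v) <= minn e u + minn e v], the bounds at the single primes add up, and one
    truncation at [e] suffices for the whole sum. *)
Lemma cut_Omega_mul e s a b : all prime s ->
  minn e (cut_Omega e s a + cut_Omega e s b) <= cut_Omega e s (a * b).
Proof.
elim: s => [|p s IHs] /=; first by rewrite /cut_Omega !big_nil.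
case/andP=> pp /IHs; rewrite /cut_Omega !big_cons.
have := cut_val_mul e p a b pp; lia.
Qed.

Lemma cut_Omega_mod e s m q : {in s, forall p, p ^ e %| q} ->
  cut_Omega e s (m %% q) = cut_Omega e s m.
Proof.
by move=> dv; rewrite /cut_Omega; apply: eq_big_seq => p /dv; apply: cut_val_mod.
Qed.

Lemma coprime_prod_exp e p s : prime p -> all prime s -> p \notin s ->
  coprime (p ^ e) (\prod_(q <- s) q ^ e).
Proof.
move=> pp; elim: s => [|q s IHs] /=; first by rewrite big_nil coprimen1.
case/andP=> pq ps; rewrite inE negb_or => /andP[npq nps].
rewrite big_cons coprimeMr IHs // andbT coprimeXl // coprimeXr //.
by rewrite prime_coprime // dvdn_prime2.
Qed.

End CutValuation.


(** * Independence by the Chinese remainder theorem, and generating polynomials *)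

Lemma sum_coprime_mul (R : comNzRingType) (a b : nat) (f g : nat -> R) :
  (0 < a)%N -> (0 < b)%N -> coprime a b ->
  (forall m, f (m %% a)%N = f m) -> (forall m, g (m %% b)%N = g m) ->
  \sum_(m < a * b) f m * g m = (\sum_(m < a) f m) * (\sum_(m < b) g m).
Proof.
move=> a0 b0 cab fa gb.
rewrite big_distrlr /= pair_big /=.
pose h (m : 'I_(a * b)) : 'I_a * 'I_b :=
  (Ordinal (ltn_pmod m a0), Ordinal (ltn_pmod m b0)).
have ab0 : (0 < a * b)%N by rewrite muln_gt0 a0.
pose k (u : 'I_a * 'I_b) : 'I_(a * b) := Ordinal (ltn_pmod (chinese a b u.1 u.2) ab0).
rewrite (reindex h) /=; first by apply: eq_bigr => m _; rewrite fa gb.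
exists k => [m _|[u v] _].
  apply: val_inj => /=.
  by rewrite -chinese_mod // modn_small.
congr pair; apply: val_inj => /=.
  by rewrite modn_dvdm ?dvdn_mulr // chinese_modl // modn_small.
by rewrite modn_dvdm ?dvdn_mull // chinese_modr // modn_small.
Qed.

Section GeneratingPolynomial.
Variable R : realFieldType.
Implicit Types (e p : nat) (s : seq nat).

Definition prime_gen e p : {poly R} := \sum_(m < p ^ e) 'X^(cut_val e p m).

Lemma Omega_gen_prod e s : uniq s -> all prime s ->
  \sum_(m < \prod_(p <- s) p ^ e) 'X^(cut_Omega e s m) = \prod_(p <- s) prime_gen e p.
Proof.
elim: s => [|p s IHs] /=.
  by rewrite !big_nil big_ord1 /cut_Omega big_nil expr0.
case/andP=> nps us /andP[pp ps]; rewrite !big_cons -IHs //.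
rewrite /prime_gen -(sum_coprime_mul _ _ _ (fun m => 'X^(cut_val e p m))
  (fun m => 'X^(cut_Omega e s m))).
- by apply: eq_bigr => m _; rewrite /cut_Omega big_cons exprD.
- by rewrite expn_gt0 prime_gt0.
- rewrite big_seq prodn_cond_gt0 // => q /(allP ps)/prime_gt0.
  by rewrite expn_gt0 => ->.
- exact: coprime_prod_exp.
- by move=> m; rewrite cut_val_mod.
- move=> m; rewrite cut_Omega_mod // => q qs.
  by rewrite (big_rem q) //= dvdn_mulr.
Qed.

Lemma sum_ord_mul (V : nmodType) (p M : nat) (f : nat -> V) :
  \sum_(m < p * M) f m = \sum_(q < M) \sum_(r < p) f (p * q + r)%N.
Proof.
elim: M => [|M IHM]; first by rewrite muln0 !big_ord0.
by rewrite mulnS addnC big_split_ord big_ord_recr /= IHM.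
Qed.

(** Write a residue modulo [p ^ e.+1] as [p * q + r] with [r < p]. If [r = 0], the valuation is one
    more than that of [q]; the other [p.-1] values of [r] give valuation 0. *)
Lemma prime_genS e p : prime p ->
  prime_gen e.+1 p = ((p.-1 * p ^ e)%N%:R)%:P + prime_gen e p * 'X.
Proof.
case: p => // p pp; rewrite /prime_gen expnS.
rewrite (sum_ord_mul _ _ _ (fun m => 'X^(cut_val e.+1 p.+1 m))).
have row (m : nat) : \sum_(r < p.+1) 'X^(cut_val e.+1 p.+1 (p.+1 * m + r)) =
     (p%:R)%:P + 'X^(cut_val e p.+1 m) * 'X :> {poly R}.
  rewrite big_ord_recl /= addn0 cut_valS_mul // exprSr addrC; congr (_ + _).
  rewrite (eq_bigr (fun=> 1)) ?sumr_const ?card_ord ?rmorph_nat // => r _.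
  rewrite cut_val_ndvd //.
  rewrite /bump /= add1n dvdn_addr ?dvdn_mulr //.
  by apply/negP => /dvdn_leq; have := ltn_ord r; lia.
under eq_bigr do rewrite row.
rewrite big_split /= sumr_const card_ord -mulr_suml; congr (_ + _).
by rewrite natrM mulr_natr [RHS]rmorphMn.
Qed.

(** Up to the factor [p ^ e], this is a geometric law of ratio [1 / p] whose tail from [e] on is
    concentrated at [e], on the single residue 0. *)
Lemma coef_prime_gen e p i : prime p ->
  (prime_gen e p)`_i =
  if (i < e)%N then p%:R ^+ e * (1 - p%:R^-1) * p%:R^-1 ^+ i else (i == e)%:R.
Proof.
move=> pp; have p0 : p%:R != 0 :> R by rewrite pnatr_eq0; case: p pp.
elim: e i => [|e IHe] i.
  by rewrite /prime_gen big_ord1 /cut_val /= gcdn1 logn1 coef1.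
rewrite prime_genS // coefD coefC coefMX; case: i => [|i] /=.
  rewrite addr0 expr0 mulr1 exprS natrM natrX.
  have -> : p.-1%:R = p%:R - 1 :> R.
    by rewrite -[in RHS](prednK (prime_gt0 pp)) -natr1 addrK.
  by field.
rewrite add0r IHe ltnS eqSS; case: ifP => // _.
by rewrite exprS exprSr; field.
Qed.

End GeneratingPolynomial.

(** * Coefficientwise domination by a Poisson generating function *)

Section Domination.
Variable R : realFieldType.
Implicit Types (f g : {poly R}) (N : nat).

(** Nonnegativity is built in so that the relation is stable under products; degrees above [N] are
    ignored because the majorants are truncated series. *)
Definition coef_dom N f g := forall i, (i <= N)%N -> 0 <= f`_i <= g`_i.

Lemma coef_dom_mul N f1 f2 g1 g2 :
  coef_dom N f1 g1 -> coef_dom N f2 g2 -> coef_dom N (f1 * f2) (g1 * g2).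
Proof.
move=> d1 d2 i iN; rewrite !coefM.
have h (j : 'I_i.+1) : (0 <= f1`_j <= g1`_j) && (0 <= f2`_(i - j) <= g2`_(i - j)).
  by rewrite d1 ?d2 //; have := ltn_ord j; lia.
apply/andP; split.
  by apply: sumr_ge0 => j _; have /andP[/andP[? _] /andP[? _]] := h j; apply: mulr_ge0.
by apply: ler_sum => j _; have /andP[/andP[? ?] /andP[? ?]] := h j; apply: ler_pM.
Qed.

Lemma coef_dom_trans N f g h : coef_dom N f g -> coef_dom N g h -> coef_dom N f h.
Proof.
move=> fg gh i iN; have /andP[f0 fgi] := fg i iN; have /andP[_ ghi] := gh i iN.
by rewrite f0 (le_trans fgi).
Qed.

Lemma coef_dom_refl N f : (forall i, 0 <= f`_i) -> coef_dom N f f.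
Proof. by move=> f0 i _; rewrite f0 lexx. Qed.

Definition exp_trunc N (w : R) : {poly R} := \poly_(i < N.+1) (w ^+ i / i`!%:R).

(* [1 + w^2 z^2 + w^3 z^3 + ...], a coefficientwise majorant of
   [exp (- w z) / (1 - w z)]. *)
Definition correction N (w : R) : {poly R} := \poly_(i < N.+1) ((i != 1%N)%:R * w ^+ i).

Lemma coef_exp_trunc_ge0 N w i : 0 <= w -> 0 <= (exp_trunc N w)`_i.
Proof. by move=> w0; rewrite coef_poly; case: ifP => // _; rewrite divr_ge0 ?exprn_ge0. Qed.

Lemma coef_correction_ge0 N w i : 0 <= w -> 0 <= (correction N w)`_i.
Proof. by move=> w0; rewrite coef_poly; case: ifP => // _; rewrite mulr_ge0 ?exprn_ge0. Qed.

Lemma natr_fact_neq0 k : k`!%:R != 0 :> R.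
Proof. by rewrite pnatr_eq0 -lt0n fact_gt0. Qed.

(** By the binomial theorem the two sides even agree in degrees up to [N]. *)
Lemma exp_truncD N (a b : R) : 0 <= a -> 0 <= b ->
  coef_dom N (exp_trunc N a * exp_trunc N b) (exp_trunc N (a + b)).
Proof.
move=> a0 b0 i iN; apply/andP; split.
  by rewrite coefM; apply: sumr_ge0 => j _; rewrite mulr_ge0 ?coef_exp_trunc_ge0.
rewrite coefM coef_poly ltnS iN [in X in _ <= X]addrC exprDn mulr_suml.
apply: ler_sum => j _.
rewrite !coef_poly !ltnS (leq_trans _ iN) -1?ltnS ?ltn_ord // ltnS (leq_trans (leq_subr _ _) iN).
rewrite -mulr_natr; have ji : (j <= i)%N by rewrite -ltnS.
rewrite -(bin_fact ji) !natrM.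
have bn0 : 'C(i, j)%:R != 0 :> R by rewrite pnatr_eq0 -lt0n bin_gt0.
have := natr_fact_neq0 j; have := natr_fact_neq0 (i - j) => u v.
rewrite le_eqVlt; apply/orP; left; apply/eqP.
by field; rewrite bn0 u v.
Qed.

(** For [i >= 3] the terms [j = i] and [j = i - 1] of the convolution contribute [w ^+ i] each. For
    [i = 2] the second one meets the missing linear term of [correction]. *)
Lemma coef_exp_correction_ge N (w : R) i : 0 <= w -> (i <= N)%N ->
  (if (i < 3)%N then 1 else 2) * w ^+ i <= (exp_trunc N w * correction N w)`_i.
Proof.
move=> w0 iN; rewrite coefMr.
rewrite (eq_bigr (fun j : 'I_i.+1 => (nat_of_ord j != 1%N)%:R / (i - j)`!%:R * w ^+ i)); last first.
  move=> j _; have ji : (j <= i)%N by rewrite -ltnS.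
  rewrite !coef_poly !ltnS (leq_trans (leq_subr _ _) iN) (leq_trans ji iN).
  have -> : w ^+ i = w ^+ (i - j) * w ^+ j by rewrite -exprD subnK.
  by field; rewrite natr_fact_neq0.
rewrite -mulr_suml ler_wpM2r ?exprn_ge0 //.
have nn (j : nat) : 0 <= (j != 1%N)%:R / (i - j)`!%:R :> R by rewrite divr_ge0.
case: i iN nn => [|[|[|i]]] iN nn /=.
- by rewrite big_ord1 /= divr1.
- by rewrite big_ord_recl /= divr1 lerDl sumr_ge0.
- by rewrite big_ord_recr /= divr1 lerDr sumr_ge0.
- rewrite big_ord_recr big_ord_recr /= subnn subSnn /= !divr1.
  by rewrite -addrA lerDr sumr_ge0.
Qed.

(** Only the coefficient at [i = e], which is 1, exceeds its geometric value [1 - 1 / p]. As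
    [e >= 3], the factor 2 of the previous bound is available there, and [2 (1 - 1 / p) >= 1]. *)
Lemma prime_gen_dom N e p : prime p -> (3 <= e)%N ->
  coef_dom N (prime_gen R e p)
    ((p%:R ^+ e * (1 - p%:R^-1))%:P * (exp_trunc N p%:R^-1 * correction N p%:R^-1)).
Proof.
move=> pp e3 i iN; rewrite coefCM coef_prime_gen //.
have p2 : 2 <= p%:R :> R by rewrite (ler_nat _ 2) prime_gt1.
have w0 : 0 <= p%:R^-1 :> R by rewrite invr_ge0.
have w2 : p%:R^-1 <= 2^-1 :> R by rewrite lef_pV2 ?posrE //; lra.
have c0 : 0 <= p%:R ^+ e * (1 - p%:R^-1) :> R.
  by rewrite mulr_ge0 ?exprn_ge0 //; lra.
have /(ler_wpM2l c0) le := coef_exp_correction_ge N _ i w0 iN.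
apply/andP; split.
  by case: ifP => // _; rewrite mulr_ge0 ?exprn_ge0.
apply: le_trans le; case: ifPn => ie.
  apply: ler_wpM2l => //; apply: ler_peMl; first exact: exprn_ge0.
  by case: ifP => // _; lra.
case: eqVneq => [->|_] /=; last first.
  by rewrite mulr_ge0 // mulr_ge0 ?exprn_ge0 //; case: ifP.
rewrite ltnNge e3 /= exprVn.
have pe : p%:R ^+ e != 0 :> R by rewrite expf_neq0 //; lra.
have -> : p%:R ^+ e * (1 - p%:R^-1) * (2 * (p%:R ^+ e)^-1) = 2 * (1 - p%:R^-1) :> R.
  by field; rewrite pe /=; lra.
lra.
Qed.

Lemma prod_prime_gen_dom N e s : all prime s -> (3 <= e)%N ->
  coef_dom N (\prod_(p <- s) prime_gen R e p)
    ((\prod_(p <- s) (p%:R ^+ e * (1 - p%:R^-1)))%:P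
      * (exp_trunc N (\sum_(p <- s) p%:R^-1) * \prod_(p <- s) correction N p%:R^-1)).
Proof.
move=> + e3; elim: s => [_|p s IHs /= /andP[pp ps]].
  rewrite !big_nil mulr1 mul1r => i iN.
  rewrite coef1 coef_poly ltnS iN expr0n.
  by case: i iN => [|i] _ /=; rewrite ?fact0 ?divr1 ?lexx ?ler01 // mul0r lexx.
rewrite !big_cons.
have := coef_dom_mul _ _ _ _ _ (prime_gen_dom N e p pp e3) (IHs ps).
move/coef_dom_trans; apply.
set c1 := _ * (1 - _); set c2 := \prod_(_ <- _) _; set l := \sum_(_ <- _) _.
set h := correction _ _; set K := \prod_(_ <- _) correction _ _.
have c10 : 0 <= c1.
  rewrite mulr_ge0 ?exprn_ge0 // subr_ge0 invf_le1 ?ltr0n ?prime_gt0 //.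
  by rewrite (ler_nat _ 1) prime_gt0.
have c20 : 0 <= c2.
  rewrite /c2 big_seq prodr_ge0 // => q /(allP ps) pq.
  rewrite mulr_ge0 ?exprn_ge0 // subr_ge0 invf_le1 ?ltr0n ?prime_gt0 //.
  by rewrite (ler_nat _ 1) prime_gt0.
have l0 : 0 <= l by apply: sumr_ge0 => q _; rewrite invr_ge0.
have hK : coef_dom N (h * K) (h * K).
  apply: coef_dom_mul.
    by apply: coef_dom_refl => i; apply: coef_correction_ge0; rewrite invr_ge0.
  rewrite /K; elim: (s) => [|q t IHt].
    by rewrite big_nil; apply: coef_dom_refl => i; rewrite coef1.
  rewrite big_cons; apply: coef_dom_mul IHt.
  by apply: coef_dom_refl => i; apply: coef_correction_ge0; rewrite invr_ge0.
have cc : coef_dom N (c1 * c2)%:P (c1 * c2)%:P.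
  by apply: coef_dom_refl => i; rewrite coefC; case: ifP => // _; rewrite mulr_ge0.
have -> : c1%:P * (exp_trunc N p%:R^-1 * h) * (c2%:P * (exp_trunc N l * K)) =
   (c1 * c2)%:P * (exp_trunc N p%:R^-1 * exp_trunc N l * (h * K)).
  by rewrite (polyCM c1 c2); ring.
apply: coef_dom_mul => //; apply: coef_dom_mul => //.
by apply: exp_truncD; rewrite ?invr_ge0.
Qed.

(** The ratio of consecutive weights [J ^ m / m!] is [J / (m + 1)], so they increase up to [m = J]
    and do not increase afterwards. *)
Lemma expn_fact_mode (J m : nat) : (J ^ m * J`! <= J ^ J * m`!)%N.
Proof.
have [mJ|/ltnW Jm] := leqP m J.
  have up d : (m + d <= J)%N -> ((m + d)`! <= m`! * J ^ d)%N.
    elim: d => [|d IHd] le; first by rewrite addn0 muln1.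
    rewrite addnS factS expnS mulnCA leq_mul // ?IHd //; lia.
  have := up (J - m)%N; rewrite subnKC // => /(_ (leqnn J)) le.
  rewrite -{4}(subnKC mJ) expnD -mulnA leq_mul2l; apply/orP; right.
  by rewrite mulnC.
have up d : (J ^ d * J`! <= (J + d)`!)%N.
  elim: d => [|d IHd]; first by rewrite addn0 mul1n.
  by rewrite addnS factS expnS -mulnA leq_mul //; lia.
by rewrite -{1}(subnKC Jm) expnD -mulnA leq_mul // -{2}(subnKC Jm).
Qed.

End Domination.

(** * Tail bounds by exponential tilting *)

Section Tails.
Variable R : realFieldType.
Implicit Types (f K : {poly R}) (N J : nat) (C l w y rho : R).

Lemma sum_coef_le_horner K rho J : (forall i, 0 <= K`_i) -> 0 <= rho ->
  \sum_(i < J) K`_i * rho ^+ i <= K.[rho].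
Proof.
move=> K0 r0; rewrite (@horner_coef_wide _ (J + size K)) ?leq_addl //.
by rewrite big_split_ord /= lerDl sumr_ge0 // => i _; rewrite mulr_ge0 ?exprn_ge0.
Qed.

(* Exponential tilting by [rho = J / l]: the tilted Poisson weights
   [(l rho)^m / m! = J^m / m!] are maximal at [m = J]. *)
Lemma coef_le_tilted N f K C l J j :
  0 <= C -> 0 < l -> (0 < J)%N -> (forall i, 0 <= K`_i) ->
  coef_dom R N f (C%:P * (exp_trunc R N l * K)) -> (j <= N)%N ->
  f`_j <= C * (J%:R ^+ J / J`!%:R) * K.[J%:R / l] * (l / J%:R) ^+ j.
Proof.
move=> C0 l0 J0 K0 dom jN; have /andP[_] := dom j jN; move/le_trans; apply.
rewrite coefCM -!mulrA ler_wpM2l // coefMr.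
have J0R : 0 < J%:R :> R by rewrite ltr0n.
have r0 : 0 < J%:R / l by rewrite divr_gt0.
have sE : l / J%:R = (J%:R / l)^-1 by rewrite invf_div.
have s0 : 0 <= (l / J%:R) ^+ j by rewrite exprn_ge0 // divr_ge0 ?ltW.
(* In the [i]-th term of the convolution, [(l / J) ^ (j - i)] splits as [(l / J) ^ j * rho ^ i]; the
   powers of [rho] then assemble to a partial sum of [K.[rho]]. *)
apply: (@le_trans _ _ (J%:R ^+ J / J`!%:R *
    ((\sum_(i < j.+1) K`_i * (J%:R / l) ^+ i) * (l / J%:R) ^+ j))); last first.
  rewrite -!mulrA ler_wpM2l ?exprn_ge0 // ler_wpM2l ?invr_ge0 // ler_wpM2r //.
  by rewrite sum_coef_le_horner // ltW.
rewrite mulr_suml mulr_sumr; apply: ler_sum => i _.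
have ij : (i <= j)%N by rewrite -ltnS.
rewrite coef_poly ltnS (leq_trans (leq_subr _ _) jN).
have -> : J%:R ^+ J / J`!%:R * (K`_i * (J%:R / l) ^+ i * (l / J%:R) ^+ j) =
   J%:R ^+ J / J`!%:R * (l / J%:R) ^+ (j - i) * K`_i.
  have -> : (l / J%:R) ^+ j = (l / J%:R) ^+ (j - i) * (l / J%:R) ^+ i.
    by rewrite -exprD subnK.
  by rewrite {2}sE exprVn; field; rewrite expf_neq0 ?gt_eqF //= natr_fact_neq0.
rewrite ler_wpM2r //; move: (j - i)%N => m.
rewrite expr_div_n ler_pdivrMr ?ltr0n ?fact_gt0 //.
have -> : J%:R ^+ J / J`!%:R * (l ^+ m / J%:R ^+ m) * m`!%:R =
   l ^+ m * (J ^ J * m`!)%:R / (J ^ m * J`!)%:R :> R.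
  rewrite !natrM !natrX; field.
  by rewrite expf_neq0 ?natr_fact_neq0 // gt_eqF.
rewrite ler_pdivlMr ?ltr0n ?muln_gt0 ?expn_gt0 ?J0 ?fact_gt0 //.
by rewrite ler_wpM2l ?exprn_ge0 ?(ltW l0) // ler_nat expn_fact_mode.
Qed.

Lemma geo_sum_lt (s : R) J : 1 < s -> \sum_(j < J) s ^+ j <= s ^+ J / (s - 1).
Proof.
move=> s1; have s10 : 0 < s - 1 by rewrite subr_gt0.
by rewrite ler_pdivlMr // mulrC -subrX1 lerBlDr lerDl.
Qed.

Lemma geo_sum_ge (s : R) J N : 0 < s < 1 ->
  \sum_(J <= j < N) s ^+ j <= s ^+ J / (1 - s).
Proof.
case/andP=> s0 s1; have s10 : 0 < 1 - s by rewrite subr_gt0.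
have [NJ|/ltnW JN] := leqP N J.
  by rewrite big_geq // divr_ge0 ?exprn_ge0 ?ltW.
rewrite ler_pdivlMr // -(subnK JN); set d := (N - J)%N.
suff : (\sum_(J <= j < d + J) s ^+ j) * (1 - s) <= s ^+ J - s ^+ (d + J).
  by move/le_trans; apply; rewrite lerBlDr lerDl exprn_ge0 ?ltW.
elim: d => [|d IHd]; first by rewrite big_geq // mul0r subrr.
rewrite addSn big_nat_recr /= ?leq_addl // mulrDl exprS; lra.
Qed.

(** The tilted bounds grow with ratio [l / J > 1], so their sum is controlled by the last ones;
    [J ^ J] cancels against the denominator of [(l / J) ^ J], which leaves the Poisson weight
    [l ^ J / J!]. *)
Lemma lower_tail N f K C l J :
  0 <= C -> 0 < l -> (0 < J <= N)%N -> J%:R < l -> (forall i, 0 <= K`_i) ->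
  coef_dom R N f (C%:P * (exp_trunc R N l * K)) ->
  \sum_(j < J) f`_j <= C * K.[J%:R / l] * (l ^+ J / J`!%:R) / (l / J%:R - 1).
Proof.
move=> C0 l0 /andP[J0 JN] Jl K0 dom.
have J0R : 0 < J%:R :> R by rewrite ltr0n.
have s1 : 1 < l / J%:R by rewrite ltr_pdivlMr // mul1r.
set M := C * (J%:R ^+ J / J`!%:R) * K.[J%:R / l].
have KK : 0 <= K.[J%:R / l].
  apply: le_trans (sum_coef_le_horner _ _ 0 K0 _); first by rewrite big_ord0.
  by rewrite divr_ge0 ?ltW.
have M0 : 0 <= M by rewrite /M !mulr_ge0 ?invr_ge0 ?exprn_ge0.
apply: (@le_trans _ _ (\sum_(j < J) M * (l / J%:R) ^+ j)).
  apply: ler_sum => j _; apply: (coef_le_tilted N) => //.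
  by rewrite (leq_trans _ JN) // ltnW.
rewrite -mulr_sumr; apply: le_trans (ler_wpM2l M0 (geo_sum_lt _ J s1)) _.
rewrite /M le_eqVlt; apply/orP; left; apply/eqP; rewrite !expr_div_n; field.
rewrite natr_fact_neq0 expf_neq0 ?gt_eqF //=; lra.
Qed.

Lemma upper_tail N f K C l J :
  0 <= C -> 0 < l -> (0 < J)%N -> l < J%:R -> (forall i, 0 <= K`_i) ->
  coef_dom R N f (C%:P * (exp_trunc R N l * K)) ->
  \sum_(J <= j < N.+1) f`_j <= C * K.[J%:R / l] * (l ^+ J / J`!%:R) / (1 - l / J%:R).
Proof.
move=> C0 l0 J0 Jl K0 dom.
have J0R : 0 < J%:R :> R by rewrite ltr0n.
have s1 : 0 < l / J%:R < 1 by rewrite divr_gt0 //= ltr_pdivrMr // mul1r.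
set M := C * (J%:R ^+ J / J`!%:R) * K.[J%:R / l].
have KK : 0 <= K.[J%:R / l].
  apply: le_trans (sum_coef_le_horner _ _ 0 K0 _); first by rewrite big_ord0.
  by rewrite divr_ge0 ?ltW.
have M0 : 0 <= M by rewrite /M !mulr_ge0 ?invr_ge0 ?exprn_ge0.
apply: (@le_trans _ _ (\sum_(J <= j < N.+1) M * (l / J%:R) ^+ j)).
  rewrite big_nat_cond [in X in _ <= X]big_nat_cond; apply: ler_sum => j.
  by rewrite andbT ltnS => /andP[_ jN]; apply: coef_le_tilted jN.
rewrite -mulr_sumr; apply: le_trans (ler_wpM2l M0 (geo_sum_ge _ J _ s1)) _.
rewrite /M le_eqVlt; apply/orP; left; apply/eqP; rewrite !expr_div_n; field.
rewrite natr_fact_neq0 expf_neq0 ?gt_eqF //=; lra.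
Qed.

(** With [y = w rho], the full series is [1 + y^2 / (1 - y)], and [1 / (1 - y) <= 4]. *)
Lemma horner_correction_le N w rho : 0 <= w * rho <= 3 / 4 ->
  (correction R N w).[rho] <= 1 + 4 * (w * rho) ^+ 2.
Proof.
rewrite horner_poly => /andP[]; set y := w * rho => y0 y34.
rewrite (eq_bigr (fun i : 'I_N.+1 => (nat_of_ord i != 1%N)%:R * y ^+ i)); last first.
  by move=> i _; rewrite -mulrA -exprMn.
case: N => [|N].
  by rewrite big_ord1 /= mul1r expr0 lerDl mulr_ge0 // exprn_ge0.
(* The subtracted term makes the induction close: [y^n <= 4 y^n - 4 y^(n+1)] for [y <= 3 / 4]. *)
suff : \sum_(i < N.+2) (nat_of_ord i != 1%N)%:R * y ^+ i <= 1 + 4 * y ^+ 2 - 4 * y ^+ N.+2.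
  by move/le_trans; apply; rewrite lerBlDr lerDl mulr_ge0 // exprn_ge0.
elim: N => [|N IHN].
  rewrite !big_ord_recr big_ord0 /= expr0; lra.
rewrite big_ord_recr /= mul1r.
have := exprn_ge0 N.+2 y0; rewrite (exprS y N.+2); nra.
Qed.

(** The range of [rho] is dictated by [p = 2], for which [rho / p] reaches [3 / 4]; the 9 is the
    largest value of [4 rho^2]. *)
Lemma horner_prod_correction_le N rho (s : seq nat) : all prime s -> 0 <= rho <= 3 / 2 ->
  (\prod_(p <- s) correction R N p%:R^-1).[rho] <= \prod_(p <- s) (1 + 9 / p%:R ^+ 2).
Proof.
move=> ps /andP[r0 r1]; rewrite horner_prod big_seq [in X in _ <= X]big_seq.
apply: ler_prod => p /(allP ps) pp.
have p2 : 2 <= p%:R :> R by rewrite (ler_nat _ 2) prime_gt1.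
have w0 : 0 <= p%:R^-1 :> R by rewrite invr_ge0.
have w2 : p%:R^-1 <= 2^-1 :> R by rewrite lef_pV2 ?posrE //; lra.
apply/andP; split.
  rewrite horner_poly; apply: sumr_ge0 => i _.
  by rewrite !mulr_ge0 ?exprn_ge0.
have wr : 0 <= p%:R^-1 * rho <= 3 / 4 by apply/andP; split; nra.
apply: le_trans (horner_correction_le N _ _ wr) _.
rewrite lerD2l -exprVn exprMn.
have : rho ^+ 2 <= 9 / 4 by rewrite expr2; nra.
have := exprn_ge0 2 w0; nra.
Qed.

End Tails.

(** * From tail bounds to the density of the product-free set *)

Section Density.
Variable R : realType.

Lemma product_free_cut_Omega e s k : all prime s -> (2 * k <= e)%N ->
  product_free [set m : 'I_(\prod_(p <- s) p ^ e) | (k <= cut_Omega e s m < 2 * k)%N].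
Proof.
move=> ps ke.
apply/forallP => a; apply/implyP; rewrite inE => /andP[ka _].
apply/forallP => b; apply/implyP; rewrite inE => /andP[kb _].
apply/forallP => c; apply/implyP; rewrite inE => /andP[_ kc].
apply/negP => /eqP abc.
have dv : {in s, forall p, p ^ e %| \prod_(p <- s) p ^ e}%N.
  by move=> q qs; rewrite (big_rem q) //= dvdn_mulr.
have := cut_Omega_mul e s a b ps.
rewrite -(cut_Omega_mod e s (a * b) _ dv) abc cut_Omega_mod //; lia.
Qed.

Lemma sum_coef_gen (n N : nat) (X : nat -> nat) (phi : nat -> R) :
  (forall m : 'I_n, X m <= N)%N ->
  \sum_(m < n) phi (X m) = \sum_(j < N.+1) (\sum_(m < n) 'X^(X m) : {poly R})`_j * phi j.
Proof.
move=> XN; under [RHS]eq_bigr do rewrite coef_sum mulr_suml.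
rewrite exchange_big /=; apply: eq_bigr => m _.
have lt : (X m < N.+1)%N by rewrite ltnS.
rewrite (bigD1 (Ordinal lt)) //= big1 ?addr0; first by rewrite coefXn eqxx mul1r.
move=> j /eqP nj; rewrite coefXn; case: eqP => [jX|_]; last by rewrite mul0r.
by case: nj; apply: val_inj.
Qed.

Lemma density_le_max n (S : {set 'I_n}) : product_free S -> density R S <= max_density R n.
Proof. by move=> pS; rewrite /max_density; apply: le_bigmax_cond. Qed.

(** The complement of [S] is made of the tails below [k] and from [2 k] on. The hypotheses place [l]
    strictly between the two thresholds and keep both tilts [k / l] and [2 k / l] below [3 / 2]. *)
Lemma max_density_ge e s k (l := \sum_(p <- s) p%:R^-1 : R) :
  uniq s -> all prime s -> (3 <= e)%N -> (2 * k <= e)%N -> (0 < k)%N ->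
  k%:R < l -> l < (2 * k)%:R -> (2 * k)%:R <= 3 / 2 * l ->
  1 - max_density R (\prod_(p <- s) p ^ e) <=
    \prod_(p <- s) (1 - p%:R^-1) * \prod_(p <- s) (1 + 9 / p%:R ^+ 2) *
    (l ^+ k / k`!%:R / (l / k%:R - 1) +
     l ^+ (2 * k) / (2 * k)`!%:R / (1 - l / (2 * k)%:R)).
Proof.
move=> us ps e3 ke k0 kl lk kl2.
set n := (\prod_(p <- s) p ^ e)%N; set X := cut_Omega e s.
pose S : {set 'I_n} := [set m : 'I_n | (k <= X m < 2 * k)%N].
have n0 : (0 < n)%N.
  by rewrite /n big_seq prodn_cond_gt0 // => q /(allP ps)/prime_gt0; rewrite expn_gt0 => ->.
have n0R : 0 < n%:R :> R by rewrite ltr0n.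
apply: (@le_trans _ _ (1 - density R S)).
  by rewrite lerD2l lerN2 density_le_max // product_free_cut_Omega.
(* [N] bounds every value of [X], so the truncated series miss no residue, and [k <= N] is what the
   lower tail requires. *)
pose N := maxn k (\max_(m < n) X m).
have XN (m : 'I_n) : (X m <= N)%N.
  by rewrite leq_max (@leq_bigmax _ (fun m : 'I_n => X m) m) orbT.
have kN : (k <= N)%N by rewrite leq_maxl.
set c := \prod_(p <- s) (1 - _); set H := \prod_(p <- s) (1 + _).
pose G : {poly R} := \prod_(p <- s) prime_gen R e p.
pose C := \prod_(p <- s) (p%:R ^+ e * (1 - p%:R^-1)) : R.
pose K := \prod_(p <- s) correction R N p%:R^-1.
have dom : coef_dom R N G (C%:P * (exp_trunc R N l * K)) by apply: prod_prime_gen_dom.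
(* The factor [n] cancels against the normalisation of the density; the product of the [1 - 1 / p]
   remains. *)
have CE : C = n%:R * c.
  by rewrite /C big_split /= natr_prod; under [in RHS]eq_bigr do rewrite natrX.
have c0 : 0 <= c.
  rewrite /c big_seq prodr_ge0 // => q /(allP ps) pq.
  by rewrite subr_ge0 invf_le1 ?ltr0n ?prime_gt0 // (ler_nat _ 1) prime_gt0.
have C0 : 0 <= C by rewrite CE mulr_ge0.
have l0 : 0 < l by apply: le_lt_trans kl.
have K0 i : 0 <= K`_i.
  rewrite /K; elim: (s) i => [|q t IHt] i; first by rewrite big_nil coef1.
  rewrite big_cons coefM; apply: sumr_ge0 => j _.
  by rewrite mulr_ge0 // coef_correction_ge0 // invr_ge0.
have S1 : 1 - density R S <= n%:R^-1 * (\sum_(j < k) G`_j + \sum_(2 * k <= j < N.+1) G`_j).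
  have cS : #|S|%:R + \sum_(m < n) ((X m < k)%N%:R + (2 * k <= X m)%N%:R) = n%:R :> R.
    rewrite -sum1_card natr_sum big_mkcond /= -big_split /=.
    rewrite (eq_bigr (fun=> 1)) ?sumr_const ?card_ord // => m _.
    rewrite inE; case: (ltnP (X m) k) => a; case: (ltnP (X m) (2 * k)) => b /=;
      rewrite ?addr0 ?add0r //; lia.
  have -> : 1 - density R S = n%:R^-1 * (n%:R - #|S|%:R).
    by rewrite /density; field; rewrite gt_eqF.
  rewrite -{2}cS addrC addKr (sum_coef_gen _ N X (fun j => (j < k)%N%:R + (2 * k <= j)%N%:R)) //.
  rewrite Omega_gen_prod // -/G ler_wpM2l ?invr_ge0 //.
  under eq_bigr do rewrite mulrDr.
  rewrite big_split /= (big_ord_widen N.+1 (fun j => G`_j)) ?leqW // big_geq_mkord.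
  rewrite [in X in _ <= X + _]big_mkcond [in X in _ <= _ + X]big_mkcond /=.
  by rewrite lerD // ler_sum // => j _; case: ifP => _; rewrite ?mulr1 ?mulr0.
have k0R : 0 < k%:R :> R by rewrite ltr0n.
have kl' : (2 * k)%:R = 2 * k%:R :> R by rewrite natrM.
have kr : 0 <= k%:R / l <= 3 / 2.
  rewrite divr_ge0 ?(ltW l0) //= ler_pdivrMr //; lra.
have kr2 : 0 <= (2 * k)%:R / l <= 3 / 2.
  by rewrite divr_ge0 ?(ltW l0) //= ler_pdivrMr.
have A1 := lower_tail _ _ _ _ _ _ k C0 l0 (introT andP (conj k0 kN)) kl K0 dom.
have k20 : (0 < 2 * k)%N by rewrite muln_gt0 k0.
have A2 := upper_tail _ _ _ _ _ _ (2 * k) C0 l0 k20 lk K0 dom.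
have H1 := horner_prod_correction_le R N _ _ ps kr.
have H2 := horner_prod_correction_le R N _ _ ps kr2.
rewrite -/K -/H in H1 H2.
have d1 : 0 <= l ^+ k / k`!%:R / (l / k%:R - 1).
  rewrite !divr_ge0 ?exprn_ge0 ?(ltW l0) // subr_ge0 ler_pdivlMr // mul1r.
  exact: ltW.
have d2 : 0 <= l ^+ (2 * k) / (2 * k)`!%:R / (1 - l / (2 * k)%:R).
  rewrite !divr_ge0 ?exprn_ge0 ?(ltW l0) // subr_ge0 ler_pdivrMr ?mul1r ?(ltW lk) //.
  by rewrite ltr0n.
apply: le_trans S1 _; rewrite mulrC ler_pdivrMr //.
rewrite -mulrA in A1; rewrite -mulrA in A2.
have B1 := le_trans A1 (ler_wpM2r d1 (ler_wpM2l C0 H1)).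
have B2 := le_trans A2 (ler_wpM2r d2 (ler_wpM2l C0 H2)).
apply: le_trans (lerD B1 B2) _.
by rewrite CE le_eqVlt; apply/orP; left; apply/eqP; ring.
Qed.

End Density.

(** * Numerical bounds on [e] and [ln 2], and Stirling's lower bound *)

Section Analysis.
Import numFieldNormedType.Exports.
Variable R : realType.
Implicit Types (x y t w a l : R).

Lemma expR1_ge94 : 9 / 4 <= expR 1 :> R.
Proof.
have -> : 1 = 2%:R * 2^-1 :> R by field.
rewrite expRM_natl; have := expR_ge1Dx (2^-1 : R); rewrite expr2; nra.
Qed.

(** From [exp (- 1 / 6) >= 5 / 6] follows [e <= (6 / 5)^6 < 3]. *)
Lemma expR1_lt3 : expR 1 < 3 :> R.
Proof.
have h : expR 6^-1 <= 6 / 5 :> R.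
  have := expR_ge1Dx (- 6^-1 : R); rewrite expRN => h.
  have e0 := expR_gt0 (6^-1 : R).
  have : (5 / 6) * expR 6^-1 <= (expR 6^-1)^-1 * expR 6^-1 :> R.
    by rewrite ler_wpM2r ?(ltW e0) //; lra.
  by rewrite mulVf ?gt_eqF //; lra.
have -> : 1 = 6%:R * 6^-1 :> R by field.
rewrite expRM_natl; apply: (@le_lt_trans _ _ ((6 / 5) ^+ 6)).
  by rewrite lerXn2r // ?nnegrE ?expR_ge0 //; lra.
lra.
Qed.

Lemma ln2_lt1 : ln 2 < 1 :> R.
Proof.
rewrite -ltr_expR lnK ?posrE //; have := expR1_ge94; lra.
Qed.

(* Strict convexity at [ln 2 != 1] gives [ln 2 < expR (ln 2 - 1) = 2 / e]. *)
Lemma expR1_ln2_lt2 : expR 1 * ln 2 < 2 :> R.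
Proof.
have h := @expR_gt1Dx R (ln 2 - 1).
have : ln 2 - 1 != 0 :> R by rewrite lt_eqF // subr_lt0 ln2_lt1.
move/h; rewrite expRD lnK ?posrE // expRN addrC subrK => lt.
by rewrite mulrC -ltr_pdivlMr ?expR_gt0.
Qed.

(** The difference vanishes at 0 and has derivative [(exp u - 1)^2 / exp u >= 0]. *)
Lemma sinh_ge t : 0 <= t -> 2 * t <= expR t - expR (- t).
Proof.
move=> t0; pose f (u : R) := expR u - expR (- u) - 2 * u.
have df (u : R) : is_derive u 1 f (expR u + expR (- u) - 2).
  rewrite /f; apply: is_derive_eq.
  by rewrite /GRing.scale /=; ring.
have cf : continuous f.
  by move=> u; apply/differentiable_continuous/derivable1_diffP; case: (df u).
have : f 0 <= f t.
  apply: (@ger0_derive1_le_cc _ f 0 t) => //.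
  - move=> u _; rewrite derive1E; have [_ ->] := df u.
    have e0 := expR_gt0 u; rewrite expRN.
    have -> : expR u + (expR u)^-1 - 2 = (expR u - 1) ^+ 2 / expR u.
      by field; rewrite gt_eqF.
    by rewrite divr_ge0 ?sqr_ge0 ?ltW.
  - exact: continuous_subspaceT.
  - by rewrite in_itv /= lexx.
  - by rewrite in_itv /= t0 lexx.
by rewrite /f oppr0 subrr mulr0 subrr subr_ge0.
Qed.

Lemma ln_le_sinh x : 1 <= x -> ln x <= (x - x^-1) / 2.
Proof.
move=> x1; have x0 : 0 < x by apply: lt_le_trans x1.
have := sinh_ge _ (ln_ge0 x1); rewrite expRN lnK ?posrE //; lra.
Qed.

Lemma stirling_lower J : (0 < J)%N ->
  (J%:R + 2^-1) * ln J%:R - J%:R <= ln (J`!%:R : R).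
Proof.
case: J => // J _.
(* The term [1 / (4 J)] telescopes against the error made in bounding [(J + 1 / 2) ln (1 + 1 / J)];
   the constant [3 / 4] gives equality at [J = 1]. *)
suff : (J.+1%:R + 2^-1) * ln J.+1%:R - J.+1%:R + 3 / 4 + (4 * J.+1%:R)^-1
    <= ln (J.+1`!%:R : R).
  have : 0 <= (4 * J.+1%:R)^-1 :> R by rewrite invr_ge0.
  set v := (4 * _)^-1; lra.
elim: J => [|J IHJ]; first by rewrite ln1 mulr0 mulr1; lra.
rewrite factS natrM lnM ?posrE ?ltr0n ?fact_gt0 //.
have J0 : 0 < J.+1%:R :> R by rewrite ltr0n.
have JE : J.+2%:R = J.+1%:R + 1 :> R by rewrite -natr1.
move: IHJ; rewrite JE; move: (J.+1%:R : R) J0 => j j0 IH.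
have lnE : ln (j + 1) = ln j + ln (1 + j^-1).
  rewrite -lnM ?posrE //; first by congr ln; field; rewrite gt_eqF.
  by rewrite addr_gt0 // invr_gt0.
have h : ln (1 + j^-1) <= (1 + j^-1 - (1 + j^-1)^-1) / 2.
  by apply: ln_le_sinh; rewrite lerDl invr_ge0 ltW.
have {}h : (j + 2^-1) * ln (1 + j^-1) <= 1 + (4 * j)^-1 - (4 * (j + 1))^-1.
  apply: le_trans (ler_wpM2l _ h) _; first lra.
  rewrite le_eqVlt; apply/orP; left; apply/eqP; field.
  by rewrite !gt_eqF //; lra.
rewrite lnE; nra.
Qed.

(** Stirling bounds the weight by [(e l / J)^J / sqrt J], and the tangent bound for [ln (a l / J)]
    makes the exponent linear in [l] and [J]. The loss is small when [J] is close to [a l], so [a]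
    can stay fixed while [J] is rounded to an integer. *)
Lemma poisson_weight_le a l J : 0 < a -> 0 < l -> (0 < J)%N ->
  l ^+ J / J`!%:R <= expR (a * l - J%:R * ln a) / Num.sqrt J%:R.
Proof.
move=> a0 l0 J0; have J0R : 0 < J%:R :> R by rewrite ltr0n.
have f0 : 0 < J`!%:R :> R by rewrite ltr0n fact_gt0.
have s0 : 0 < Num.sqrt (J%:R : R) by rewrite sqrtr_gt0.
rewrite -ler_ln ?posrE ?divr_gt0 ?exprn_gt0 ?expR_gt0 //.
rewrite !ln_div ?posrE ?exprn_gt0 ?expR_gt0 // expRK lnXn // -[ln l *+ J]mulr_natl.
have -> : ln (Num.sqrt J%:R) = 2^-1 * ln J%:R :> R.
  have : ln (Num.sqrt J%:R * Num.sqrt J%:R) = ln J%:R :> R.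
    by rewrite -expr2 sqr_sqrtr // ltW.
  by rewrite lnM ?posrE //; lra.
have st := stirling_lower J J0.
have : ln (1 + (a * l / J%:R - 1)) <= a * l / J%:R - 1.
  apply: le_ln1Dx; rewrite ltrBrDl subrr.
  by rewrite divr_gt0 // mulr_gt0.
rewrite addrC subrK ln_div ?posrE ?mulr_gt0 // lnM ?posrE // => h.
have {}h : J%:R * (ln a + ln l - ln J%:R) <= a * l - J%:R.
  have -> : a * l - J%:R = J%:R * (a * l / J%:R - 1) by field; rewrite gt_eqF.
  by rewrite ler_wpM2l // ltW.
lra.
Qed.

(** * Euler's product and sums over primes *)

Lemma ln_le_harmonic (n : nat) : ln n.+1%:R <= \sum_(1 <= m < n.+1) m%:R^-1 :> R.
Proof.
elim: n => [|n IHn]; first by rewrite ln1 big_geq.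
rewrite big_nat_recr //=.
have n0 : 0 < n.+1%:R :> R by rewrite ltr0n.
have -> : n.+2%:R = n.+1%:R * (1 + n.+1%:R^-1) :> R.
  by rewrite -[LHS]natr1; field; rewrite gt_eqF.
have i0 : 0 < n.+1%:R^-1 :> R by rewrite invr_gt0.
rewrite lnM ?posrE ?addr_gt0 // lerD // le_ln1Dx // (lt_trans _ i0) // ltrN10.
Qed.

Lemma sum_dvdn (k y : nat) (F : nat -> R) : (0 < k)%N ->
  \sum_(1 <= m < y.+1 | (k %| m)%N) F m = \sum_(1 <= m < (y %/ k).+1) F (k * m)%N.
Proof.
move=> k0; elim: y => [|y IHy]; first by rewrite div0n !big_geq.
rewrite big_mkcond big_nat_recr //= -big_mkcond /= IHy divnS //.
case: ifP => dv /=; last by rewrite addr0 add0n.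
rewrite add1n [RHS]big_nat_recr //=; congr (_ + F _).
by rewrite -[LHS](divnK dv) divnS // dv add1n mulnC.
Qed.

Definition smooth_below (k m : nat) : bool := all (fun p => p < k)%N (primes m).

(* Write [T k] for the sum over the [m <= x] with all prime factors below [k].
   For [k] prime, dividing the multiples of [k] by [k] gives
   [T (k + 1) <= T k + T (k + 1) / k]. *)
Lemma euler_product_le (x : nat) :
  (\sum_(1 <= m < x.+1) m%:R^-1) * \prod_(0 <= p < x.+1 | prime p) (1 - p%:R^-1) <= 1 :> R.
Proof.
pose f k m : R := if smooth_below k m then m%:R^-1 else 0.
have f0 k m : 0 <= f k m by rewrite /f; case: ifP => // _; rewrite invr_ge0.
pose T k := \sum_(1 <= m < x.+1) f k m.
pose P k := \prod_(0 <= p < k | prime p) (1 - p%:R^-1) : R.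
have P0 k : 0 <= P k.
  by apply: prodr_ge0 => p pp; rewrite subr_ge0 invf_le1 ?ltr0n ?prime_gt0 // (ler_nat _ 1) prime_gt0.
have TP k : T k * P k <= 1.
  elim: k => [|k IHk].
    (* For [k = 0] only [m = 1], which has no prime factor, is counted. *)
    rewrite /P big_geq // mulr1 /T; case: x @T => [|y] T; first by rewrite big_geq.
    rewrite big_nat_recl //= /f /smooth_below /= invr1 big_nat_cond big1 ?addr0 //.
    move=> m /andP[/andP[m1 _] _]; case E: (primes m.+1) => [|q t] //=.
    by have := primes_eq0 m.+1; rewrite E eqxx ltnS; lia.
  rewrite /P big_mkcond big_nat_recr //= -big_mkcond /= -/(P k).
  case: ifPn => [pk|npk]; last first.
    rewrite mulr1; suff -> : T k.+1 = T k by [].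
    apply: eq_bigr => m _; rewrite /f /smooth_below.
    have -> // : all (fun p => p < k.+1)%N (primes m) = all (fun p => p < k)%N (primes m).
    apply: eq_in_all => q; rewrite mem_primes => /and3P[pq _ _].
    rewrite ltnS leq_eqVlt; case: eqVneq => [qk|] //.
    by move: npk; rewrite -qk pq.
  have k0 := prime_gt0 pk; have k0R : 0 < k%:R :> R by rewrite ltr0n.
  suff h : T k.+1 * (1 - k%:R^-1) <= T k.
    by apply: le_trans IHk; rewrite mulrCA mulrC ler_wpM2r // mulrC.
  suff : T k.+1 <= T k + k%:R^-1 * T k.+1 by lra.
  rewrite {1}/T (bigID (fun m => (k %| m)%N)) /= addrC lerD //.
    rewrite big_mkcond; apply: ler_sum => m _; case: ifPn => // ndv.
    rewrite /f.
    have -> : smooth_below k.+1 m = smooth_below k m; last by [].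
    apply: eq_in_all => q; rewrite mem_primes => /and3P[pq _ dq].
    rewrite ltnS leq_eqVlt; case: eqVneq => [qk|] //.
    by move: ndv; rewrite -qk dq.
  rewrite sum_dvdn // /T.
  apply: (@le_trans _ _ (\sum_(1 <= m < (x %/ k).+1) k%:R^-1 * f k.+1 m)).
    rewrite big_nat_cond [in X in _ <= X]big_nat_cond; apply: ler_sum => m /andP[/andP[m1 _] _].
    rewrite /f; have [sm|nsm] := boolP (smooth_below k.+1 m).
      by case: ifP => _; rewrite ?natrM ?invfM // mulr_ge0 ?invr_ge0.
    have -> : smooth_below k.+1 (k * m) = false; last by rewrite mulr0.
    apply: contraNF nsm; move=> /allP sm; apply/allP => q qm.
    by apply: sm; rewrite primesM // qm orbT.
  rewrite -mulr_sumr ler_wpM2l ?invr_ge0 //.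
  rewrite [in X in _ <= X](@big_cat_nat _ _ _ (x %/ k).+1) //= ?ltnS ?leq_div //.
  by rewrite lerDl sumr_ge0.
(* Prime factors of [m <= x] are below [x + 1], so [T x.+1] is the whole harmonic sum. *)
have := TP x.+1; rewrite /P; congr (_ * _ <= _).
rewrite /T big_nat_cond [RHS]big_nat_cond; apply: eq_bigr => m /andP[/andP[m1 mx] _].
rewrite /f; case: ifPn => // /negP[]; apply/allP => q.
by rewrite mem_primes => /and3P[_ _ /dvdn_leq le]; apply: leq_ltn_trans (le m1) mx.
Qed.

(** A crude bound that serves to check [2 k <= x] for [k] near [e l / 4]. *)
Lemma sum_prime_inv_le (x : nat) : \sum_(0 <= p < x.+1 | prime p) p%:R^-1 <= x%:R / 2 :> R.
Proof.
elim: x => [|x IHx]; first by rewrite big_mkcond big_nat1 /= mul0r.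
rewrite big_mkcond big_nat_recr //= -big_mkcond /=.
have : (if prime x.+1 then x.+1%:R^-1 else 0) <= 2^-1 :> R.
  case: ifP => [px|_]; last by lra.
  by rewrite lef_pV2 ?posrE // (ler_nat _ 2) prime_gt1.
set u := (if _ then _ else _); rewrite -(natr1 x); lra.
Qed.

Lemma sum_prime_invsq_le1 (x : nat) : \sum_(0 <= p < x.+1 | prime p) (p%:R^-1) ^+ 2 <= 1 :> R.
Proof.
case: x => [|x]; first by rewrite big_mkcond big_nat1.
suff : \sum_(0 <= p < x.+2 | prime p) (p%:R^-1) ^+ 2 <= 1 - x.+1%:R^-1 :> R.
  by move/le_trans; apply; rewrite lerBlDr lerDl invr_ge0.
elim: x => [|x IHx].
  by rewrite big_mkcond !big_nat_recr //= big_geq //= !addr0 invr1 subrr.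
rewrite big_mkcond big_nat_recr //= -big_mkcond /=.
have x0 : 0 < x.+1%:R :> R by rewrite ltr0n.
have : (if prime x.+2 then x.+2%:R^-1 ^+ 2 else 0) <= x.+1%:R^-1 - x.+2%:R^-1 :> R.
  apply: (@le_trans _ _ (x.+2%:R^-1 ^+ 2)); first by case: ifP => // _; rewrite exprn_ge0 ?invr_ge0.
  rewrite -[x.+2%:R]natr1; move: (x.+1%:R : R) x0 => j j0.
  have -> : j^-1 - (j + 1)^-1 = (j + 1)^-1 * j^-1 by field; rewrite !gt_eqF //; lra.
  rewrite expr2; apply: ler_wpM2l; first by rewrite invr_ge0; lra.
  by rewrite lef_pV2 ?posrE; lra.
by move=> h; apply: le_trans (lerD IHx h) _; rewrite addrA subrK.
Qed.

Definition primes_upto (x : nat) : seq nat := [seq p <- index_iota 0 x.+1 | prime p].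

Lemma all_primes_upto (x : nat) : all prime (primes_upto x).
Proof. exact: filter_all. Qed.

Lemma uniq_primes_upto (x : nat) : uniq (primes_upto x).
Proof. by rewrite filter_uniq // iota_uniq. Qed.

Lemma prod_prime_le_expR (s : seq nat) : all prime s ->
  \prod_(p <- s) (1 - p%:R^-1) <= expR (- \sum_(p <- s) p%:R^-1) :> R.
Proof.
move=> ps; rewrite -sumrN expR_sum big_seq [in X in _ <= X]big_seq.
apply: ler_prod => p /(allP ps) pp; rewrite expR_ge1Dx andbT.
by rewrite subr_ge0 invf_le1 ?ltr0n ?prime_gt0 // (ler_nat _ 1) prime_gt0.
Qed.

(** For [0 <= w <= 1 / 2], [1 / (1 - w) <= 1 + w + 2 w^2 <= exp (w + 2 w^2)]. *)
Lemma expR_le_prod_prime (s : seq nat) : all prime s ->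
  expR (- \sum_(p <- s) p%:R^-1 - 2 * \sum_(p <- s) p%:R^-1 ^+ 2)
    <= \prod_(p <- s) (1 - p%:R^-1) :> R.
Proof.
move=> ps; rewrite -sumrN mulr_sumr -sumrB expR_sum big_seq [in X in _ <= X]big_seq.
apply: ler_prod => p /(allP ps) pp; rewrite expR_ge0 /=.
have p2 : 2 <= p%:R :> R by rewrite (ler_nat _ 2) prime_gt1.
have w0 : 0 <= p%:R^-1 :> R by rewrite invr_ge0.
have w2 : p%:R^-1 <= 2^-1 :> R by rewrite lef_pV2 ?posrE //; lra.
move: (p%:R^-1 : R) w0 w2 => w w0 w2.
rewrite -opprD expRN invf_ple ?posrE ?expR_gt0 //; last lra.
apply: le_trans (expR_ge1Dx _).
rewrite -div1r ler_pdivrMr; last lra.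
rewrite expr2; nra.
Qed.

Lemma prod_correction_le (s : seq nat) :
  \prod_(p <- s) (1 + 9 / p%:R ^+ 2) <= expR (9 * \sum_(p <- s) p%:R^-1 ^+ 2) :> R.
Proof.
rewrite mulr_sumr expR_sum; apply: ler_prod => p _.
rewrite exprVn expR_ge1Dx andbT addr_ge0 // divr_ge0 // exprn_ge0 //.
Qed.

(** The lower half of Mertens' second theorem: [ln x] is at most the harmonic sum, hence at most the
    inverse of Euler's product; the 2 bounds [2 * q] since [q <= 1]. *)
Lemma ln_le_expR_sum_primes (x : nat) : (1 < x)%N ->
  ln x%:R <= expR (\sum_(p <- primes_upto x) p%:R^-1 + 2) :> R.
Proof.
move=> x1; have := euler_product_le x; have := ln_le_harmonic x.
have := expR_le_prod_prime _ (all_primes_upto x).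
have := sum_prime_invsq_le1 x.
rewrite -!(big_filter _ prime) -/(primes_upto x).
set l := \sum_(p <- _) _^-1; set q := \sum_(p <- _) _ ^+ 2; set c := \prod_(_ <- _) _.
set h := \sum_(_ <= _ < _) _ => q1 cl hl hc.
have lx : ln x%:R <= ln x.+1%:R :> R.
  by rewrite ler_ln ?posrE ?ltr0n ?ler_nat // ltnW.
have le2 : expR (- (l + 2)) <= c.
  by apply: le_trans cl; rewrite ler_expR; lra.
rewrite expRN in le2.
have e0 := expR_gt0 (l + 2); have ei : 0 < (expR (l + 2))^-1 by rewrite invr_gt0.
have h0 : 0 <= h by apply: le_trans hl; rewrite ln_ge0 // (ler_nat _ 1).
have : h / expR (l + 2) <= 1 by apply: le_trans hc; rewrite ler_wpM2l.
rewrite ler_pdivrMr // mul1r; lra.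
Qed.

End Analysis.

Local Open Scope classical_set_scope.
Local Open Scope ring_scope.

(** * The modulus, its iterated logarithms, and the choice of [k] *)

Section Asymptotics.
Variable R : realType.
Implicit Types (x : nat) (l : R).

Definition modulus x : nat := \prod_(p <- primes_upto x) p ^ x.

Lemma modulus_gt x : (1 < x)%N -> (x < modulus x)%N.
Proof.
move=> x1; apply: (@leq_trans (2 ^ x)); first exact: ltn_expl.
apply: dvdn_leq.
  rewrite /modulus big_seq prodn_cond_gt0 // => p /(allP (all_primes_upto x))/prime_gt0.
  by rewrite expn_gt0 => ->.
rewrite /modulus (big_rem 2) /=; first exact: dvdn_mulr.
by rewrite mem_filter /= mem_index_iota.
Qed.

Lemma modulus_le x : (0 < x)%N -> (modulus x <= x ^ (x * x.+1))%N.
Proof.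
move=> x0; rewrite /modulus big_filter big_mkcond.
apply: (@leq_trans (\prod_(0 <= p < x.+1) x ^ x)%N).
  rewrite big_nat_cond [X in (_ <= X)%N]big_nat_cond; apply: leq_prod => p.
  rewrite andbT ltnS => /andP[_ px]; case: ifP => _; last by rewrite expn_gt0 x0.
  by rewrite leq_exp2r.
by rewrite prod_nat_const_nat subn0 -expnM.
Qed.

(** A crude power is enough: the exponent 4 becomes an additive constant in the triple logarithm. *)
Lemma ln_modulus_le x : (1 < x)%N -> ln (modulus x)%:R <= x%:R ^+ 4 :> R.
Proof.
move=> x1; have x0 : 0 < x%:R :> R by rewrite ltr0n ltnW.
apply: (@le_trans _ _ (ln (x ^ (x * x.+1))%:R)).
  rewrite ler_ln ?posrE ?ltr0n ?ler_nat ?modulus_le ?expn_gt0 ?(ltnW x1) //.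
  by rewrite (leq_trans _ (modulus_gt x x1)).
rewrite natrX lnXn // -[ln _ *+ _]mulr_natl.
apply: (@le_trans _ _ ((x * x.+1)%:R * x%:R)).
  by rewrite ler_wpM2l // ltW // ln_sublinear.
rewrite -natrM -natrX ler_nat; nia.
Qed.

Lemma lnlnln_modulus_le x : 1 <= ln (x%:R : R) ->
  ln (ln (ln (modulus x)%:R)) <= \sum_(p <- primes_upto x) p%:R^-1 + 4 :> R.
Proof.
move=> lx1; set l := \sum_(_ <- _) _.
have x1 : (1 < x)%N.
  rewrite ltnNge; apply/negP => x1; move: lx1; rewrite leNgt => /negP[].
  by apply: le_lt_trans (ln_le0 _) ltr01; rewrite (ler_nat _ _ 1).
have x0 : 0 < x%:R :> R by rewrite ltr0n ltnW.
have n0 : 0 < (modulus x)%:R :> R.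
  by rewrite ltr0n (leq_trans _ (modulus_gt x x1)).
have lnn : ln x%:R <= ln (modulus x)%:R :> R.
  by rewrite ler_ln ?posrE // ler_nat ltnW // modulus_gt.
have L4 : ln (ln (modulus x)%:R) <= 4 * ln x%:R :> R.
  apply: (@le_trans _ _ (ln (x%:R ^+ 4))).
    rewrite ler_ln ?posrE ?exprn_gt0 ?ln_modulus_le //.
    by apply: lt_le_trans (le_trans lx1 lnn).
  by rewrite lnXn // mulr_natl.
(* In the first case the outer logarithm takes its default value 0. *)
have [L0|L0] := leP (ln (ln (modulus x)%:R) : R) 0.
  rewrite ln0 // addr_ge0 // sumr_ge0 // => p _; rewrite invr_ge0 //.
have -> : l + 4 = ln (expR 2 * expR (l + 2)) by rewrite -expRD expRK; ring.
rewrite ler_ln ?posrE ?mulr_gt0 ?expR_gt0 //.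
apply: le_trans L4 _; apply: ler_pM; rewrite ?(le_trans _ lx1) //.
  have -> : 2 = 2%:R * 1 :> R by rewrite mulr1.
  rewrite expRM_natl; have := expR1_ge94 R; rewrite expr2; nra.
exact: ln_le_expR_sum_primes.
Qed.

Lemma one_sub_max_density_le x (l := \sum_(p <- primes_upto x) p%:R^-1 : R) :
  (3 <= x)%N -> 32 <= l ->
  1 - max_density R (modulus x) <=
    expR 9 * (6 + 17 * expR 2) *
    (expR (- (1 - 1 / 2 * expR 1 * ln 2) * l) / Num.sqrt l).
Proof.
move=> x3 l32.
have e1 := expR1_ge94 R; have e2 := expR1_lt3 R; have ln1 := ln2_lt1 R.
have ln2 : 1 <= 2 * ln 2 :> R.
  rewrite -ler_expR -[2 * ln 2]/(2%:R * ln 2) expRM_natl lnK ?posrE //; lra.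
have l0 : 0 < l by lra.
have lx : l <= x%:R / 2 by rewrite /l big_filter sum_prime_inv_le.
(* For [J = a l] the exponent [a l - J ln a] is [a (1 - ln a) l]. It has the same value
   [(e / 2) (ln 2) l] at [a = e / 4] and at [a = e / 2], so the tails at [k] and [2 k] balance. *)
pose k := Num.truncn (expR 1 / 4 * l).
have /andP[k1 k2] : k%:R <= expR 1 / 4 * l < k.+1%:R.
  by apply: truncn_itv; rewrite mulr_ge0 ?divr_ge0 ?expR_ge0 // ltW.
rewrite -(natr1 k) in k2.
have el : 9 / 4 * l <= expR 1 * l by rewrite ler_wpM2r // ltW.
have el2 : expR 1 * l <= 3 * l by rewrite ler_wpM2r // ltW.
have k0R : 1 < k%:R :> R by lra.
have k0 : (0 < k)%N by rewrite -(ltr_nat R); lra.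
have kk : (2 * k)%:R = 2 * k%:R :> R by rewrite natrM.
have kx : (2 * k <= x)%N by rewrite -(ler_nat R); lra.
have kl : k%:R < l by lra.
have lk : l < (2 * k)%:R by lra.
have kl2 : (2 * k)%:R <= 3 / 2 * l by lra.
have := max_density_ge R x _ k (uniq_primes_upto x) (all_primes_upto x) x3 kx k0 kl lk kl2.
rewrite -/(modulus x) -/l => /le_trans; apply.
set c := \prod_(_ <- _) (1 - _); set H := \prod_(_ <- _) (1 + _).
have cl : c <= expR (- l) by apply/prod_prime_le_expR/all_primes_upto.
have H9 : H <= expR 9.
  apply: le_trans (prod_correction_le _ _) _.
  by rewrite ler_expR big_filter; have := sum_prime_invsq_le1 R x; lra.
have c0 : 0 <= c.
  rewrite /c big_seq prodr_ge0 // => q /(allP (all_primes_upto x)) pq.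
  by rewrite subr_ge0 invf_le1 ?ltr0n ?prime_gt0 // (ler_nat _ 1) prime_gt0.
have H0 : 0 <= H.
  by apply: prodr_ge0 => q _; rewrite addr_ge0 // divr_ge0 // exprn_ge0.
set E := expR (1 / 2 * expR 1 * ln 2 * l).
have sl : 0 < Num.sqrt l by rewrite sqrtr_gt0.
have lnE4 : ln (expR 1 / 4) = 1 - 2 * ln 2 :> R.
  rewrite ln_div ?posrE ?expR_gt0 // expRK.
  by have -> : 4 = 2 ^+ 2 :> R by [rewrite expr2; ring]; rewrite lnXn // mulr_natl.
have lnE2 : ln (expR 1 / 2) = 1 - ln 2 :> R.
  by rewrite ln_div ?posrE ?expR_gt0 // expRK.
have U1 : l ^+ k / k`!%:R / (l / k%:R - 1) <= 6 * (E / Num.sqrt l).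
  (* As [ln (e / 4) <= 0], rounding [k] down does not raise the exponent; the factor 2 comes from
     [k >= l / 4] under the square root. *)
  have w := poisson_weight_le R (expR 1 / 4) l k _ l0 k0.
  have {}w : l ^+ k / k`!%:R <= 2 * (E / Num.sqrt l).
    apply: le_trans (w _) _; first by rewrite divr_gt0 ?expR_gt0.
    have -> : 2 * (E / Num.sqrt l) = E * (2 / Num.sqrt l) by ring.
    apply: ler_pM; rewrite ?expR_ge0 ?invr_ge0 ?sqrtr_ge0 //.
      by rewrite ler_expR lnE4; nra.
    have -> : 2 / Num.sqrt l = (Num.sqrt l / 2)^-1 by rewrite invf_div.
    rewrite lef_pV2 ?posrE ?divr_gt0 ?sqrtr_gt0 //; last by lra.
    have -> : Num.sqrt l / 2 = Num.sqrt (l / 4).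
      rewrite sqrtrM ?ltW //; congr (_ * _).
      have -> : 4^-1 = (2^-1) ^+ 2 :> R by rewrite expr2; field.
      by rewrite sqrtr_sqr ger0_norm.
    by rewrite ler_wsqrtr //; lra.
  (* Since [e < 3], [k <= 3 l / 4]. *)
  have d : 3^-1 <= l / k%:R - 1.
    by rewrite lerBrDr ler_pdivlMr; lra.
  have di : (l / k%:R - 1)^-1 <= 3.
    by rewrite -[3]invrK lef_pV2 ?posrE //; lra.
  have -> : 6 * (E / Num.sqrt l) = (2 * (E / Num.sqrt l)) * 3 by ring.
  apply: ler_pM => //; rewrite ?invr_ge0; last by lra.
  by rewrite divr_ge0 ?exprn_ge0 // ltW.
have U2 : l ^+ (2 * k) / (2 * k)`!%:R / (1 - l / (2 * k)%:R) <=
    17 * expR 2 * (E / Num.sqrt l).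
  have k20 : (0 < 2 * k)%N by rewrite muln_gt0 k0.
  (* Here [ln (e / 2) > 0], and rounding, which lowers [2 k] by at most 2, costs a factor at most
     [exp 2]. *)
  have w := poisson_weight_le R (expR 1 / 2) l (2 * k) _ l0 k20.
  have {}w : l ^+ (2 * k) / (2 * k)`!%:R <= expR 2 * (E / Num.sqrt l).
    apply: le_trans (w _) _; first by rewrite divr_gt0 ?expR_gt0.
    rewrite mulrA; apply: ler_pM; rewrite ?expR_ge0 ?invr_ge0 ?sqrtr_ge0 //.
      by rewrite -expRD ler_expR lnE2 kk; nra.
    by rewrite lef_pV2 ?posrE ?sqrtr_gt0 ?ler_wsqrtr //; lra.
  (* From [e >= 9 / 4], [2 k >= 9 l / 8 - 2], which is at least [17 l / 16] because [l >= 32]. *)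
  have d : 17^-1 <= 1 - l / (2 * k)%:R.
    by rewrite lerBrDr -lerBrDl ler_pdivrMr; lra.
  have di : (1 - l / (2 * k)%:R)^-1 <= 17.
    by rewrite -[17]invrK lef_pV2 ?posrE //; lra.
  have -> : 17 * expR 2 * (E / Num.sqrt l) = (expR 2 * (E / Num.sqrt l)) * 17 by ring.
  apply: ler_pM => //; rewrite ?invr_ge0; last by lra.
  by rewrite divr_ge0 ?exprn_ge0 // ltW.
have EE : expR (- (1 - 1 / 2 * expR 1 * ln 2) * l) = expR (- l) * E.
  by rewrite -expRD; congr expR; ring.
rewrite EE.
have -> : expR 9 * (6 + 17 * expR 2) * (expR (- l) * E / Num.sqrt l) =
  (expR (- l) * expR 9) * (6 * (E / Num.sqrt l) + 17 * expR 2 * (E / Num.sqrt l)).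
  by ring.
apply: ler_pM; rewrite ?mulr_ge0 //.
- rewrite addr_ge0 // divr_ge0 ?divr_ge0 ?exprn_ge0 ?(ltW l0) // subr_ge0.
    by rewrite ler_pdivlMr; lra.
  by rewrite ler_pdivrMr; lra.
- exact: ler_pM.
- exact: lerD.
Qed.

End Asymptotics.

(** * The constant and the infinitely many moduli *)

Theorem theorem1p2 (R : realType) :
  exists C : R, 0 < C /\
    infinite_set [set n : nat | (0 < n)%N /\
      max_density R n >
        1 - C / ((ln (ln (n%:R : R)) `^ (1 - 1 / 2 * expR 1 * ln 2))
                 * Num.sqrt (ln (ln (ln (n%:R : R)))))].
Proof.
set d : R := 1 - 1 / 2 * expR 1 * ln 2.
have d0 : 0 < d by rewrite /d; have := expR1_ln2_lt2 R; lra.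
pose C1 : R := expR 9 * (6 + 17 * expR 2).
have C10 : 0 <= C1 by rewrite mulr_ge0 ?expR_ge0 // addr_ge0 // mulr_ge0 ?expR_ge0.
(* The last two factors pay for replacing [l + 4] by [l], in the power and under the square root,
   where [l + 4 <= 4 l]. *)
pose C2 : R := C1 * (expR (4 * d) * 2).
have C20 : 0 <= C2 by rewrite mulr_ge0 // mulr_ge0 // expR_ge0.
(* The added 1 makes the final inequality strict. *)
exists (C2 + 1); split; first by rewrite ltr_wpDl.
move/finite_seqP => [s sE].
pose B := expR (expR 34) : R.
(* If the set were finite, listed by [s], then [modulus x > x] would be a member beyond its maximum.
   The bound [B] ensures [ln (ln x) >= 34], hence [l >= 32]. *)
pose x := maxn (\max_(i <- s) i) (Num.truncn B).+1.
have Bx : B < x%:R.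
  have B0 : 0 <= B by apply: expR_ge0.
  have /andP[_ /lt_le_trans] := truncn_itv B0; apply.
  by rewrite ler_nat leq_maxr.
have x0 : 0 < x%:R :> R by apply: le_lt_trans Bx; apply: expR_ge0.
have lnx : expR 34 <= ln x%:R :> R.
  by rewrite -[expR 34]expRK ler_ln ?posrE ?expR_gt0 // ltW.
have e34 : 35 <= expR 34 :> R by have := expR_ge1Dx (34 : R); lra.
have x3 : (3 <= x)%N.
  rewrite -(ler_nat R); apply: ltW; apply: le_lt_trans Bx.
  by have := expR_ge1Dx (expR 34 : R); rewrite /B; lra.
have x1 : (1 < x)%N by apply: leq_trans x3.
set n := modulus x; have xn : (x < n)%N := modulus_gt x x1.
have n0 : 0 < n%:R :> R by rewrite ltr0n (leq_trans _ xn).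
pose l := \sum_(p <- primes_upto x) p%:R^-1 : R.
have l32 : 32 <= l.
  have : expR 34 <= expR (l + 2).
    by apply: le_trans lnx _; apply: ln_le_expR_sum_primes.
  by rewrite ler_expR; lra.
have L1 : expR 34 <= ln n%:R :> R.
  by apply: le_trans lnx _; rewrite ler_ln ?posrE // ler_nat ltnW.
have L2 : 34 <= ln (ln n%:R) :> R.
  by rewrite -[34]expRK ler_ln ?posrE ?expR_gt0 // (lt_le_trans _ L1) ?expR_gt0.
have L3 : 0 < ln (ln (ln n%:R)) :> R by rewrite ln_gt0 //; lra.
have L4 : ln (ln (ln n%:R)) <= l + 4 :> R by apply: lnlnln_modulus_le; lra.
have sl : 0 < Num.sqrt l by rewrite sqrtr_gt0; lra.
have : n \in s.
  suff : [set` s] n by [].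
  rewrite -sE /=; split; first by rewrite (leq_trans _ xn).
  rewrite -/n.
  have Q0 : 0 < ln (ln n%:R) `^ d * Num.sqrt (ln (ln (ln n%:R))).
    by rewrite mulr_gt0 ?powR_gt0 ?sqrtr_gt0 //; lra.
  rewrite ltrBlDr -ltrBlDl ltr_pdivlMr //.
  apply: (@le_lt_trans _ _ C2); last by rewrite ltrDl.
  have Qle : ln (ln n%:R) `^ d * Num.sqrt (ln (ln (ln n%:R))) <=
      expR (d * (l + 4)) * (2 * Num.sqrt l).
    apply: ler_pM; rewrite ?powR_ge0 ?sqrtr_ge0 //.
      by rewrite /powR gt_eqF ?ler_expR ?ler_wpM2l ?(ltW d0) //; lra.
    have -> : 2 * Num.sqrt l = Num.sqrt (4 * l).
      rewrite sqrtrM //; congr (_ * _).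
      have -> : 4 = 2 ^+ 2 :> R by rewrite expr2; ring.
      by rewrite sqrtr_sqr ger0_norm.
    by rewrite ler_wsqrtr //; lra.
  have D := one_sub_max_density_le R x x3 l32; rewrite -/C1 -/d -/l -/n in D.
  apply: le_trans (ler_wpM2r (ltW Q0) D) _.
  have CE0 : 0 <= C1 * (expR (- d * l) / Num.sqrt l).
    by rewrite mulr_ge0 // divr_ge0 ?expR_ge0 // ltW.
  apply: le_trans (ler_wpM2l CE0 Qle) _.
  rewrite /C2 -mulrA ler_wpM2l // mulrDr expRD.
  have -> : expR (- d * l) / Num.sqrt l * (expR (d * l) * expR (d * 4) * (2 * Num.sqrt l)) =
    (expR (- d * l) * expR (d * l)) * (expR (d * 4) * 2) by field; rewrite gt_eqF.
  by rewrite -expRD mulNr addNr expR0 mul1r [d * 4]mulrC.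
move=> ns; have : (n <= \max_(i <- s) i)%N by rewrite (big_rem n) //= leq_maxl.
by rewrite leqNgt (leq_trans _ xn) // ltnS leq_maxl.
Qed.
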